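(* Let $\lambda=(a,a)$ be a partition of $n=2a\ge3$. Suppose that $\Gamma,\Gamma'$ are two (reduced) nb-admissible $\overline{\mathcal S_n}$-graphs such that $U(\Gamma)\simeq U(\Gamma')\simeq\overline{\mathcal D}_\lambda$. If $\Gamma$ is disconnected, then there exists an embedding from $\Gamma$ to $\Gamma'$.
   Context: **Conventions.** For $k\in\mathbb Z$, $\overline{k}$ is the unique element of $\{1,\dots,n\}$ congruent to $k$ modulo $n$; $[1,n]=\{1,\dots,n\}$. $\overline{\mathcal S_n}$ is the affine symmetric group, a Coxeter group with simple reflections $s_0=s_n,s_1,\dots,s_{n-1}$ (type $\widetilde A_{n-1}$), identified with $[1,n]$ via $s_i\leftrightarrow i$. **Tableaux.** $\mathrm{RSYT}(\lambda)$ is the set of fillings of the Young diagram of $\lambda$ (English convention) by $1,\dots,n$, each used once, with rows increasing. $\overline{\mathrm{des}}(T)=\{i\in[1,n]\mid i\text{ lies in a strictly higher row of }T\text{ than }\overline{i+1}\}$. $T,T'\in\mathrm{RSYT}(\lambda)$ are connected by a Knuth move if $\overline{\mathrm{des}}(T),\overline{\mathrm{des}}(T')$ are incomparable under inclusion and $T'$ is obtained from $T$ by interchanging $\overline i$ and $\overline{i+1}$ for some $i$ (then re-sorting rows). **Labeled graphs and $W$-graphs.** For a Coxeter group $W$ with simple reflections $I$, an $I$-labeled graph $(V,m,\tau)$ consists of a set $V$, maps $m:V\times V\to\mathbb Z[q^{\pm1/2}]$ (written $m(u\triangleright v)$) and $\tau:V\to\{\text{subsets of }I\}$, such that for each $v$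 only finitely many $w$ have $m(v\triangleright w)\ne0$ or $m(w\triangleright v)\neq0$. There is an edge $u\to v$ iff $m(u\triangleright v)\ne0$; ''disconnected'' means that the underlying undirected graph is not connected. The graph is reduced if $m(u\triangleright v)=0$ whenever $\tau(u)\subset\tau(v)$. It is nb-admissible if all $m(u\triangleright v)\in\mathbb N=\{0,1,2,\dots\}$ and $m(u\triangleright v)=m(v\triangleright u)$ whenever $\tau(u),\tau(v)$ are incomparable. Let $\mathcal H_W$ be the Iwahori–Hecke algebra over $\mathbb Z[q^{\pm1/2}]$ with generators $T_i$ ($i\in I$) satisfying the braid relations and $(T_i-q)(T_i+1)=0$. The graph is a $W$-graph if the formulas $T_i(u)=qu$ if $i\notin\tau(u)$, and $T_i(u)=-u+q^{1/2}\sum_{v:\,i\notin\tau(v)}m(u\triangleright v)\,v$ if $i\in\tau(u)$, define an $\mathcal H_W$-module structure on $\bigoplus_{v\in V}\mathbb Z[q^{\pm1/2}]v$. The simple underlying graph $U(\Gamma)$ has the same $V,\tau$, and weight $m'$ with $m'(u\triangleright v)=m'(v\triangleright u)=1$ if $m(u\triangleright v)=m(v\triangleright u)=1$, and $m'(u\triangleright v)=m'(v\triangleright u)=0$ otherwise. Isomorphisms are bijections of vertices preserving $m$ and $\tau$. A subgraph of $(V',m',\tau')$ is $(V'',m'',\tau'')$ with $V''\subset V'$, $\tau''=\tau'|_{V''}$ and $m''(u\triangleright v)\in\{m'(u\triangleright v),0\}$; an embedding $\Gamma\to\Gamma'$ is an isomorphism of $\Gamma$ onto a subgraph of $\Gamma'$.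 **The graph $\overline{\mathcal D}_\lambda$.** The $[1,n]$-labeled graph with vertex set $\mathrm{RSYT}(\lambda)$, $\tau=\overline{\mathrm{des}}$, and $m(u\triangleright v)=m(v\triangleright u)=1$ if $u,v$ are connected by a Knuth move, $0$ otherwise. *)

(* Defs.v *)
From HB Require Import structures.
From mathcomp Require Import all_boot all_order all_fingroup all_algebra.
From mathcomp Require Import fraction finmap boolp.
From mathcomp.multinomials Require Import monalg.

Set Implicit Arguments.
Unset Strict Implicit.
Unset Printing Implicit Defensive.

Import GRing.Theory.
Local Open Scope ring_scope.

(** * The ring Z[q^{1/2}, q^{-1/2}] *)

(* Writing 'X for q^{1/2}: the subring of the fraction field of Z['X] made of
   the p / 'X^k with p a polynomial. *)
Definition is_laurent (x : {fraction {poly int}}) : bool :=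
  `[< exists (p : {poly int}) (k : nat),
        x = FracField.tofrac p / FracField.tofrac 'X^k >].

Fact tofracXn_neq0 k : FracField.tofrac ('X^k : {poly int}) != 0.
Proof. by rewrite tofrac_eq0 -size_poly_eq0 size_polyXn. Qed.

Fact is_laurent_subring : subring_closed is_laurent.
Proof.
split.
- apply/asboolP; exists 1, 0%N.
  by rewrite expr0 tofrac1 divr1.
- move=> x y /asboolP[p [k ->]] /asboolP[p' [k' ->]]; apply/asboolP.
  exists (p * 'X^k' - p' * 'X^k), (k + k')%N.
  by rewrite -mulNr addf_div ?tofracXn_neq0 // mulNr exprD tofracB !tofracM.
- move=> x y /asboolP[p [k ->]] /asboolP[p' [k' ->]]; apply/asboolP.
  exists (p * p'), (k + k')%N.
  by rewrite exprD !tofracM mulf_div.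
Qed.

HB.instance Definition _ :=
  GRing.isSubringClosed.Build {fraction {poly int}} is_laurent
    is_laurent_subring.

Record laurent_frac : predArgType :=
  LaurentFrac { laurent_val : {fraction {poly int}};
                _ : is_laurent laurent_val }.

HB.instance Definition _ := [isSub for laurent_val].
HB.instance Definition _ := [Choice of laurent_frac by <:].
HB.instance Definition _ := [SubChoice_isSubComNzRing of laurent_frac by <:].

Fact is_laurent_tofrac p : is_laurent (FracField.tofrac p).
Proof. by apply/asboolP; exists p, 0%N; rewrite expr0 tofrac1 divr1. Qed.

(* The ring is locked, together with its element q^{1/2}, because unification
   would otherwise compute in the fraction field; see [laurentP]. *)
HB.lock Definition laurent_data : {R : comNzRingType & R} :=
  existT (fun R : comNzRingType => R : Type) (laurent_frac : comNzRingType)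
    (LaurentFrac (is_laurent_tofrac 'X)).

Definition laurent : comNzRingType := projT1 laurent_data.
Definition sqrtq : laurent := projT2 laurent_data.
Definition qq : laurent := sqrtq ^+ 2.

Lemma laurentP :
  exists f : {rmorphism {poly int} -> laurent},
    [/\ injective f, f 'X = sqrtq, exists y, sqrtq * y = 1
      & forall x, exists p k, x * sqrtq ^+ k = f p].
Proof.
rewrite /sqrtq /laurent laurent_data.unlock /=.
pose f (p : {poly int}) : laurent_frac := LaurentFrac (is_laurent_tofrac p).
have fB : zmod_morphism f.
  by move=> p p'; apply: val_inj; rewrite raddfB /= tofracB.
have fM : monoid_morphism f.
  split; first by apply: val_inj; rewrite rmorph1 /= tofrac1.
  by move=> p p'; apply: val_inj; rewrite rmorphM /= tofracM.
pose fA := GRing.isZmodMorphism.Build _ _ f fB.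
pose fM' := GRing.isMonoidMorphism.Build _ _ f fM.
pose F : {rmorphism {poly int} -> laurent_frac} := HB.pack f fA fM'.
exists F; split => //.
- by move=> p p' /(congr1 val) /= /eqP; rewrite tofrac_eq => /eqP.
- have lX : is_laurent (FracField.tofrac 'X)^-1.
    by apply/asboolP; exists 1, 1%N; rewrite tofrac1 div1r expr1.
  exists (LaurentFrac lX); apply: val_inj; rewrite rmorphM rmorph1 /=.
  by rewrite divff // -['X]expr1 tofracXn_neq0.
- move=> x; have /asboolP[p [k xE]] := valP x; exists p, k.
  apply: val_inj; rewrite rmorphM rmorphXn /= xE -tofracXn.
  by rewrite divfK ?tofracXn_neq0.
Qed.

(** * Coxeter data and modules over Iwahori-Hecke algebras *)

(* The entry 0 encodes an infinite order. *)
Definition coxeter_matrix (I : Type) := I -> I -> nat.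

(* The label k : 'I_n stands for the element k + 1 of [1, n], everywhere in
   this file; [ordS] is then the successor modulo n.  The Coxeter matrix is
   that of type ~A_{n-1}. *)
Definition affine_sym (n : nat) : coxeter_matrix 'I_n := fun i j =>
  if i == j then 1%N
  else if (n <= 2)%N then 0%N
  else if (j == ordS i) || (i == ordS j) then 3
  else 2.

(* [alternate k f g] is f \o g \o f \o ... with k factors. *)
Fixpoint alternate (M : Type) (k : nat) (f g : M -> M) : M -> M :=
  if k is k'.+1 then f \o alternate k' g f else id.

(* As the Hecke algebra is given by generators and relations, a module over it
   is a module over Z[q^{1/2}, q^{-1/2}] with linear operators T i satisfying
   these relations. *)
Definition hecke_module (I : eqType) (cox : coxeter_matrix I)
    (M : lmodType laurent) (T : I -> {linear M -> M}) : Prop :=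
  (forall i x, let y := T i x + x in T i y - qq *: y = 0)
  /\ (forall i j, i != j -> cox i j <> 0%N ->
        alternate (cox i j) (T i) (T j) =1 alternate (cox i j) (T j) (T i)).

(** * Labeled graphs *)

(* [lg_nbrs v] is the finite set of the w joined to v by an edge in either
   direction, so that its existence is the local finiteness condition and its
   value is determined by [lg_m]. *)
Record lgraph (I : finType) (V : choiceType) := LGraph {
  lg_m : V -> V -> laurent;
  lg_tau : V -> {set I};
  lg_nbrs : V -> {fset V};
  lg_nbrsP : forall v w,
    (w \in lg_nbrs v) = (lg_m v w != 0) || (lg_m w v != 0) }.

Section LabeledGraphs.
Context {I : finType}.

Definition incomparable (A B : {set I}) : bool :=
  ~~ (A \subset B) && ~~ (B \subset A).

Definition reduced (V : choiceType) (G : lgraph I V) : Prop :=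
  forall u v, lg_tau G u \subset lg_tau G v -> lg_m G u v = 0.

Definition nb_admissible (V : choiceType) (G : lgraph I V) : Prop :=
  (forall u v, exists k : nat, lg_m G u v = k%:R)
  /\ (forall u v, incomparable (lg_tau G u) (lg_tau G v) ->
        lg_m G u v = lg_m G v u).

(* {malg laurent[V]} is the free module with basis V, and [mkmalgU v 1] is the
   basis element v. *)
Definition wgraph (cox : coxeter_matrix I) (V : choiceType)
    (G : lgraph I V) : Prop :=
  let e (v : V) : {malg laurent[V]} := mkmalgU v 1 in
  exists2 T : I -> {linear {malg laurent[V]} -> {malg laurent[V]}},
    hecke_module cox T
    & forall i u, T i (e u) =
        if i \notin lg_tau G u then qq *: e u
        else - e u + sqrtq *: (\sum_(v <- lg_nbrs G u | i \notin lg_tau G v)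
                                  lg_m G u v *: e v).

Definition edge (V : choiceType) (G : lgraph I V) : rel V :=
  fun u v => lg_m G u v != 0.

Definition connected_graph (V : choiceType) (G : lgraph I V) : Prop :=
  forall u v, exists2 p : seq V,
    path (fun x y => edge G x y || edge G y x) u p & last u p = v.

Definition disconnected (V : choiceType) (G : lgraph I V) : Prop :=
  ~ connected_graph G.

Section Underlying.
Variables (V : choiceType) (G : lgraph I V).

Definition underlying_m (u v : V) : laurent :=
  if (lg_m G u v == 1) && (lg_m G v u == 1) then 1 else 0.

Definition underlying_nbrs (u : V) : {fset V} :=
  [fset v in lg_nbrs G u | (lg_m G u v == 1) && (lg_m G v u == 1)]%fset.

Fact underlying_nbrsP v w : (w \in underlying_nbrs v) =
  (underlying_m v w != 0) || (underlying_m w v != 0).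
Proof.
rewrite !inE /= lg_nbrsP /underlying_m [(lg_m G w v == 1) && _]andbC orbb.
by case: ifP => [/andP[/eqP-> _]|_]; rewrite ?oner_neq0 ?eqxx ?andbF.
Qed.

Definition underlying : lgraph I V :=
  LGraph (lg_tau G) underlying_nbrsP.

End Underlying.

Definition isomorphic (V V' : choiceType)
    (G : lgraph I V) (G' : lgraph I V') : Prop :=
  exists f : V -> V',
    [/\ bijective f,
        forall u v, lg_m G' (f u) (f v) = lg_m G u v
      & forall v, lg_tau G' (f v) = lg_tau G v].

Definition subgraph (V' : choiceType) (G' : lgraph I V') (P : pred V')
    (G'' : lgraph I {v : V' | P v}) : Prop :=
  (forall v, lg_tau G'' v = lg_tau G' (val v))
  /\ (forall u v, lg_m G'' u v = lg_m G' (val u) (val v) \/ lg_m G'' u v = 0).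

Definition embeds (V V' : choiceType)
    (G : lgraph I V) (G' : lgraph I V') : Prop :=
  exists (P : pred V') (G'' : lgraph I {v : V' | P v}),
    subgraph G' G'' /\ isomorphic G G''.

End LabeledGraphs.

(** * Row-standard tableaux *)

(* The box (r, j) of the Young diagram of la, rows being numbered downwards. *)
Definition box (la : seq nat) := {r : 'I_(size la) & 'I_(nth 0%N la r)}.

Definition row_standard (n : nat) (la : seq nat)
    (T : {ffun box la -> 'I_n}) : bool :=
  [forall k, #|[set b | T b == k]| == 1%N]
  && [forall b : box la, forall b' : box la,
        (tag b == tag b') && (tagged b < tagged b')%N ==> (T b < T b')%N].

Definition rsyt (n : nat) (la : seq nat) : Type :=
  {T : {ffun box la -> 'I_n} | row_standard T}.

HB.instance Definition _ n la := Finite.on (rsyt n la).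

Section AffineTableaux.
Variables (n : nat) (la : seq nat).
Implicit Types T : rsyt n la.

Definition des T : {set 'I_n} :=
  [set i | [exists b, exists b',
     [&& val T b == i, val T b' == ordS i & (tag b < tag b')%N]]].

(* T' is obtained from T by exchanging the entries i and i + 1 and then
   permuting (by s) the entries inside each row. *)
Definition knuth_move T T' : bool :=
  incomparable (des T) (des T')
  && [exists i : 'I_n, exists s : {perm box la},
        [forall b, (tag (s b) == tag b)
                   && (val T' b == tperm i (ordS i) (val T (s b)))]].

Definition dbar_m T T' : laurent := if knuth_move T T' then 1 else 0.

Definition dbar_nbrs T : {fset rsyt n la} :=
  [fset T' : rsyt n la | (dbar_m T T' != 0) || (dbar_m T' T != 0)]%fset.

Fact dbar_nbrsP T T' : (T' \in dbar_nbrs T) =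
  (dbar_m T T' != 0) || (dbar_m T' T != 0).
Proof. by rewrite !inE. Qed.

Definition dbar : lgraph 'I_n (rsyt n la) := LGraph des dbar_nbrsP.

End AffineTableaux.

(* Main.v *)
Require Import Defs.
From HB Require Import structures.
From mathcomp Require Import all_boot all_algebra.
From mathcomp Require Import perm finmap boolp zify ring.
From mathcomp.multinomials Require Import monalg.

(* A row-standard tableau of shape (a, a) is a cyclic word in the letters 1
   (upper row) and 0 (lower row), with a of each; its descents are the factors
   10. As two cyclically adjacent positions are never both descents, the
   rescaled operators q - T_i satisfy the Temperley-Lieb relations. Up to sign,
   their transposes act by e_i w = sum of m(u > w) u over the u having a
   descent at i, for w without descent at i. For i, j adjacent the relation e_i
   e_j e_i = e_i and the nonnegativity of the weights show that e_i w is the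
   word given by the Knuth move, for every w having a descent at j. For distant
   i and k, writing w = e_k w0, the relation e_i w = e_k (e_i w0) then computes
   e_i w by induction, as if 1 and 0 were parentheses and e_i were a cup-cap
   diagram: it is always a word not depending on the W-graph, except when i and
   i + 1 are matched to each other around the circle, in which case e_i w is an
   unknown multiple c of w with the letters at i and i + 1 exchanged. The Knuth
   moves bring every word to 1010... or 0101..., and one nonzero c joins these
   two. So all c vanish for a disconnected W-graph, and its other weights are
   those of any other W-graph. *)

Set Implicit Arguments.
Unset Strict Implicit.
Unset Printing Implicit Defensive.

Import GRing.Theory.
Local Open Scope nat_scope.

(** * Consequences of the Hecke relations *)

Section WGraphs.
Local Open Scope ring_scope.

(** The Laurent ring contains the domain of integer polynomials, so a nonzero polynomial can be
    cancelled. The listed values of [c] are the factors left over when matrix entries are compared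
    below. *)
Lemma laurent_natr_inj (c : laurent) (k l : nat) :
  c \in [:: 1; sqrtq * (1 + qq); qq; qq * (1 + qq)] ->
  c * k%:R = c * l%:R -> k = l.
Proof.
have [f [f_inj fX _ _]] := laurentP.
have f_reg p : p != 0 -> f p * k%:R = f p * l%:R -> k = l.
  move=> p0; rewrite -!(rmorph_nat f) -!rmorphM => /f_inj/(mulfI p0)/eqP.
  by rewrite -!polyC_natr (inj_eq (@polyC_inj _)) !natz => /eqP[].
have fqq : f ('X ^+ 2) = qq by rewrite rmorphXn /= fX.
have X0 : 'X != 0 :> {poly int} by rewrite polyX_eq0.
have X2 : 1 + 'X ^+ 2 != 0 :> {poly int}.
  by apply/eqP => /(congr1 (fun p => p.[0])); rewrite !hornerE => /eqP.
move=> cE; have [p p0 ->] : exists2 p, p != 0 & c = f p; last exact: f_reg.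
move: cE; rewrite !inE => /or4P[] /eqP->.
- by exists 1; rewrite ?rmorph1 ?oner_neq0.
- exists ('X * (1 + 'X^2)); first by rewrite mulf_neq0.
  by rewrite rmorphM rmorphD rmorph1 /= fqq fX.
- by exists 'X^2; rewrite ?expf_neq0.
- exists ('X^2 * (1 + 'X^2)); first by rewrite mulf_neq0 ?expf_neq0.
  by rewrite rmorphM rmorphD rmorph1 /= fqq.
Qed.

Section WGraphRules.
Context {I : finType} {V : choiceType} {T : finType}.
Variables (cox : coxeter_matrix I) (G : lgraph I V) (g : T -> V).
Hypotheses (g_bij : bijective g) (GW : wgraph cox G).

Local Notation tau u := (lg_tau G (g u)).

(* The matrix of q - T_i. *)
Definition cotrans (i : I) (u w : T) : laurent :=
  if i \in tau u then
    (1 + qq) * (u == w)%:R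
      - sqrtq * (if i \notin tau w then lg_m G (g u) (g w) else 0)
  else 0.

Lemma malg_fin_sum (x : {malg laurent[V]}) :
  x = \sum_u x@_(g u) *: mkmalgU (g u) 1.
Proof.
apply/malgP => v; have [h hK gK] := g_bij; rewrite raddf_sum /=.
rewrite (bigD1 (h v)) //= mcoeffZ mcoeffU gK eqxx mulr1 big1 ?addr0 // => u.
rewrite mcoeffZ mcoeffU => u_h; case: eqP => [uv|]; last by rewrite mulr0.
by rewrite -uv hK eqxx in u_h.
Qed.

(** With [F i] = q - T_i, the quadratic relation T_i^2 = (q - 1) T_i + q turns the braid relation of
    order 3 into a relation of Temperley-Lieb type. *)
Lemma cotransP : exists F : I -> {malg laurent[V]} -> {malg laurent[V]},
  [/\ forall i x w, (F i x)@_(g w) = \sum_u x@_(g u) * cotrans i u w,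
      forall i j x, i != j -> cox i j = 2%N -> F i (F j x) = F j (F i x)
    & forall i j x, i != j -> cox i j = 3%N ->
        F i (F j (F i x)) - qq *: F i x = F j (F i (F j x)) - qq *: F j x].
Proof.
have [S [quad braid] Se] := GW; exists (fun i x => qq *: x - S i x).
have SB k y z : S k (y - z) = S k y - S k z by rewrite linearB.
have SZ k c y : S k (c *: y) = c *: S k y by rewrite linearZ.
split.
- move=> i x w; rewrite mcoeffB mcoeffZ {1 2}[x]malg_fin_sum linear_sum /=.
  rewrite !(raddf_sum (mcoeff (g w))) /= mulr_sumr -sumrB.
  apply: eq_bigr => u _; rewrite linearZ /= Se !mcoeffZ /cotrans.
  have gE := inj_eq (bij_inj g_bij); case: ifPn => iu.
    by rewrite mcoeffZ mcoeffU (negPf iu); ring.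
  rewrite negbK in iu; rewrite iu mcoeffD mcoeffN mcoeffZ mcoeffU gE.
  rewrite raddf_sum /= -big_filter.
  set s := (X in \sum_(v <- X) _).
  have -> : \sum_(v <- s) (lg_m G (g u) v *: mkmalgU v 1)@_(g w) =
      if i \notin lg_tau G (g w) then lg_m G (g u) (g w) else 0.
    have su : uniq s by rewrite filter_uniq // fset_uniq.
    (* Outside the neighbours of [g u] the weight is zero, so the sum always reduces to its term at
       [g w]. *)
    have [ws|ws] := boolP (g w \in s).
      rewrite (bigD1_seq _ ws su) /= mcoeffZ mcoeffUU mulr1.
      rewrite mem_filter in ws; have /andP[-> _] := ws.
      rewrite big1 ?addr0 // => v /negPf vw.
      by rewrite mcoeffZ mcoeffU vw mulr0.
    rewrite big_seq big1 => [|v vs].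
      move: ws; rewrite mem_filter lg_nbrsP; case: ifP => //= _.
      by rewrite negb_or negbK => /andP[/eqP->].
    rewrite mcoeffZ mcoeffU; case: eqP => [vw|]; last by rewrite mulr0.
    by rewrite vw (negPf ws) in vs.
  ring.
- move=> i j x ij cij; have := braid i j ij.
  rewrite cij => /(_ (@PeanoNat.Nat.neq_succ_0 _) x) /= SS.
  rewrite !(SB, SZ) SS; apply/malgP => v.
  by rewrite !(mcoeffB, mcoeffZ); ring.
- move=> i j x ij cij; have := braid i j ij.
  rewrite cij => /(_ (@PeanoNat.Nat.neq_succ_0 _) x) /= SS.
  have Q k y : S k (S k y) = (qq - 1) *: S k y + qq *: y.
    have /= := quad k y; rewrite linearD /= => /malgP h.
    apply/malgP => v; have := h v.
    rewrite !(mcoeffB, mcoeffD, mcoeffZ, mcoeff0).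
    move/eqP; rewrite subr_eq0 => /eqP e; apply: (addIr (S k y)@_v).
    by rewrite e; ring.
  rewrite !(SB, SZ) SS !Q; apply/malgP => v.
  by rewrite !(mcoeffB, mcoeffN, mcoeffZ, mcoeffD); ring.
Qed.

Lemma cotrans_comm i j u w : i != j -> cox i j = 2%N ->
  \sum_v cotrans i u v * cotrans j v w = \sum_v cotrans j u v * cotrans i v w.
Proof.
move=> ij cij; have [F [Fc + _]] := cotransP.
move/(_ i j (mkmalgU (g u) 1) ij cij)/(congr1 (mcoeff (g w))).
have Fe k v : (F k (mkmalgU (g u) 1))@_(g v) = cotrans k u v.
  rewrite Fc (bigD1 u) //= mcoeffUU mul1r big1 ?addr0 // => x xu.
  by rewrite mcoeffU (inj_eq (bij_inj g_bij)) eq_sym (negPf xu) mul0r.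
rewrite !Fc => e.
by under eq_bigr do rewrite -Fe; under [RHS]eq_bigr do rewrite -Fe.
Qed.

Lemma cotrans_braid i j u w : i != j -> cox i j = 3%N ->
  \sum_x (\sum_v cotrans i u v * cotrans j v x) * cotrans i x w
      - qq * cotrans i u w
  = \sum_x (\sum_v cotrans j u v * cotrans i v x) * cotrans j x w
      - qq * cotrans j u w.
Proof.
move=> ij cij; have [F [Fc _ +]] := cotransP.
move/(_ i j (mkmalgU (g u) 1) ij cij)/(congr1 (mcoeff (g w))).
have Fe k v : (F k (mkmalgU (g u) 1))@_(g v) = cotrans k u v.
  rewrite Fc (bigD1 u) //= mcoeffUU mul1r big1 ?addr0 // => x xu.
  by rewrite mcoeffU (inj_eq (bij_inj g_bij)) eq_sym (negPf xu) mul0r.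
have FFe k l v : (F l (F k (mkmalgU (g u) 1)))@_(g v)
    = \sum_x cotrans k u x * cotrans l x v.
  by rewrite Fc; apply: eq_bigr => x _; rewrite Fe.
rewrite !mcoeffB !mcoeffZ !Fe !(Fc _ (F _ (F _ _))).
by under eq_bigr do rewrite FFe; under [in RHS]eq_bigr do rewrite FFe.
Qed.

Variable m : T -> T -> nat.
Hypothesis Gm : forall u v, lg_m G (g u) (g v) = (m u v)%:R.

Lemma cotransE i u w : cotrans i u w =
  if i \in tau u then (1 + qq) * (u == w)%:R
                      - sqrtq * (if i \notin tau w then (m u w)%:R else 0)
  else 0.
Proof. by rewrite /cotrans Gm. Qed.

(** In the matrix of q - T_j, row [u] is zero and column [w] has only its diagonal entry.
    Commutation thus leaves q^{1/2} (1 + q) m(u > w) = 0. *)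
Lemma wgraph_compat i j u w : i != j -> cox i j = 2%N ->
  i \in tau u -> j \notin tau u -> j \in tau w -> i \notin tau w -> m u w = 0%N.
Proof.
move=> ij cij iu ju jw iw; have := cotrans_comm u w ij cij.
rewrite [RHS]big1 => [|v _]; last by rewrite cotransE (negPf ju) mul0r.
rewrite (bigD1 w) //= [X in _ + X]big1 ?addr0 => [|v /negPf vw]; last first.
  by rewrite (cotransE j) vw jw mulr0 mulr0 subr0 if_same mulr0.
have uw : (u == w) = false by apply: contraNF iw => /eqP <-.
rewrite !cotransE iu jw iw uw eqxx !mulr0 subr0 mulr1 => /eqP h.
apply: (@laurent_natr_inj (sqrtq * (1 + qq))); first by rewrite !inE eqxx orbT.
rewrite mulr0 -[RHS]oppr0; apply/eqP; rewrite -eqr_oppLR -(eqP h); apply/eqP.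
by ring.
Qed.

(** In the (u, w) entry of the commutation, the diagonal term v = u is symmetric in [i] and [j] and
    cancels. The other terms are q times the two sums. *)
Lemma wgraph_square i j u w : i != j -> cox i j = 2%N ->
  i \in tau u -> j \in tau u -> i \notin tau w -> j \notin tau w ->
  (\sum_(v | (j \in tau v) && (i \notin tau v)) m u v * m v w =
  \sum_(v | (i \in tau v) && (j \notin tau v)) m u v * m v w)%N.
Proof.
move=> ij cij iu ju iw jw; have := cotrans_comm u w ij cij.
have sumE k l : k \in tau u -> l \in tau u -> k \notin tau w ->
    l \notin tau w ->
    \sum_v cotrans k u v * cotrans l v w = - (1 + qq) * sqrtq * (m u w)%:R
      + qq * (\sum_(v | (l \in tau v) && (k \notin tau v)) m u v * m v w)%:R.
  move=> ku lu kw lw; rewrite (bigD1 u) //= natr_sum mulr_sumr.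
  rewrite [in RHS]big_mkcond /= [in RHS](bigD1 u) //= ku andbF add0r.
  have uw : (u == w) = false by apply: contraNF kw => /eqP <-.
  congr (_ + _).
    by rewrite !cotransE ku lu lw uw eqxx !mulr0 subr0 /=; ring.
  apply: eq_bigr => v /negPf vu; rewrite !cotransE ku lw [u == v]eq_sym vu.
  have [lv|_] := boolP (l \in tau v); last by rewrite mulr0.
  have vw : (v == w) = false by apply: contraNF lw => /eqP <-.
  by rewrite vw /=; case: ifP => _; rewrite ?natrM /qq; ring.
rewrite !sumE // => /addrI; apply: laurent_natr_inj.
by rewrite !inE eqxx !orbT.
Qed.

(** This is the diagonal entry at [u] of the relation of order 3. Row [u] of q - T_j vanishes, and
    column [u] of q - T_i is diagonal with entry 1 + q, so q (1 + q) times the sum equals q (1 +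
    q). *)
Lemma wgraph_bond i j u : i != j -> cox i j = 3%N ->
  i \in tau u -> j \notin tau u ->
  (\sum_(v | (j \in tau v) && (i \notin tau v)) m u v * m v u = 1)%N.
Proof.
move=> ij cij iu ju; have := cotrans_braid u u ij cij.
have j0 v : cotrans j u v = 0 by rewrite cotransE (negPf ju).
rewrite j0 mulr0 subr0 [X in _ = X -> _]big1 => [|x _]; last first.
  by rewrite big1 ?mul0r // => v _; rewrite j0 mul0r.
rewrite (bigD1 u) //= [X in _ + X - _]big1 ?addr0 => [|x /negPf xu]; last first.
  by rewrite (cotransE i x) xu iu !mulr0 subr0 if_same mulr0.
have -> : cotrans i u u = 1 + qq by rewrite cotransE iu eqxx /=; ring.
have -> : \sum_v cotrans i u v * cotrans j v u =
    qq * (\sum_(v | (j \in tau v) && (i \notin tau v)) m u v * m v u)%:R.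
  rewrite natr_sum mulr_sumr [RHS]big_mkcond /=; apply: eq_bigr => v _.
  rewrite !cotransE iu ju.
  have [jv|_] := boolP (j \in tau v); last by rewrite mulr0.
  have vu : (v == u) = false by apply: contraNF ju => /eqP <-.
  by rewrite eq_sym vu /=; case: ifP => _; rewrite ?natrM /qq; ring.
move=> /eqP; rewrite subr_eq0 => /eqP h.
apply: (@laurent_natr_inj (qq * (1 + qq))); first by rewrite !inE eqxx !orbT.
by rewrite mulr1 -[RHS]h; ring.
Qed.

End WGraphRules.

End WGraphs.

(** * Cyclic words *)

Section Words.
Variables a n : nat.

(* The set of the positions of the letter 1 in a cyclic word. *)
Definition word : Type := {w : {set 'I_n} | #|w| == a}.
HB.instance Definition _ := Finite.on word.

Fact swap_subproof (p q : 'I_n) (w : word) : #|tperm p q @^-1: val w| == a.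
Proof. by rewrite card_preimset ?(eqP (valP w)) //; apply: perm_inj. Qed.

Definition swap p q w : word :=
  exist (fun w : {set 'I_n} => #|w| == a) _ (swap_subproof p q w).

Definition wdes (w : word) : {set 'I_n} :=
  [set i | (i \in val w) && (ordS i \notin val w)].

Definition unbonded (i j : 'I_n) := [&& i != j, j != ordS i & i != ordS j].

(** These properties are all that the combinatorics needs from a W-graph. They are stated on words
    so that graphs with different vertex sets can be compared. The first comes from the underlying
    graph, the second from nb-admissibility, the others from the Hecke relations. *)
Record wrules (m : word -> word -> nat) : Prop := WRules {
  wr_knuth : forall i w, let x := swap i (ordS i) w in
    incomparable (wdes x) (wdes w) -> m x w = 1;
  wr_sym : forall u w, incomparable (wdes u) (wdes w) -> m u w = m w u;
  wr_compat : forall i j u w, unbonded i j -> i \in wdes u ->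
    j \notin wdes u -> j \in wdes w -> i \notin wdes w -> m u w = 0;
  wr_square : forall i j u w, unbonded i j -> i \in wdes u -> j \in wdes u ->
    i \notin wdes w -> j \notin wdes w ->
    \sum_(v | (j \in wdes v) && (i \notin wdes v)) m u v * m v w =
    \sum_(v | (i \in wdes v) && (j \notin wdes v)) m u v * m v w;
  wr_bond : forall i j u, (j == ordS i) || (i == ordS j) -> i \in wdes u ->
    j \notin wdes u ->
    \sum_(v | (j \in wdes v) && (i \notin wdes v)) m u v * m v u = 1 }.

Hypothesis n_ge4 : 4 <= n.

Fact n_gt0 : 0 < n. Proof. by lia. Qed.

(* Positions are natural numbers, taken modulo n. *)
Definition pt (k : nat) : 'I_n := Ordinal (ltn_pmod k n_gt0).
Definition letter (w : word) k := pt k \in val w.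
Definition sw p q (w : word) : word := swap (pt p) (pt q) w.

Lemma ordS_pt k : ordS (pt k) = pt k.+1.
Proof. by apply: val_inj; rewrite /= -addn1 modnDml addn1. Qed.

Lemma ptDn k : pt (k + n) = pt k.
Proof. by apply: val_inj; rewrite /= modnDr. Qed.

Lemma letterDn w k : letter w (k + n) = letter w k.
Proof. by rewrite /letter ptDn. Qed.

Lemma pt_val (i : 'I_n) : pt i = i.
Proof. by apply: val_inj; rewrite /= modn_small. Qed.

Lemma pt_eq o k p : o <= k < o + n -> o <= p < o + n ->
  (pt k == pt p) = (k == p).
Proof.
wlog kp : k p / k <= p => [hw ok op|].
  by case: (leqP k p) => [|/ltnW] kp; [|rewrite eq_sym [RHS]eq_sym]; apply: hw.
move=> ok op; rewrite -val_eqE /= eq_sym eqn_mod_dvd //.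
apply/idP/eqP => [|->]; last by rewrite subnn dvdn0.
by have [|kp'] := posnP (p - k); [lia | move/(dvdn_leq kp'); lia].
Qed.

Lemma letter_sw o p q w k :
  o <= p < o + n -> o <= q < o + n -> o <= k < o + n ->
  letter (sw p q w) k =
  if k == p then letter w q else if k == q then letter w p else letter w k.
Proof.
move=> hp hq hk; rewrite /letter /sw /= inE -(pt_eq hk hp) -(pt_eq hk hq).
by rewrite permE /= !(fun_if (fun z => z \in val w)).
Qed.

Lemma word_eq o (x y : word) :
  (forall k, o <= k < o + n -> letter x k = letter y k) -> x = y.
Proof.
move=> xy; apply: val_inj; apply/setP => i; rewrite -(pt_val i).
have [k [ok ->]] : exists k, o <= k < o + n /\ pt i = pt k.
  have h1 := leq_mod o n; have h2 := ltn_pmod o n_gt0; have h3 := ltn_ord i.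
  have [oi|io] := leqP (o %% n) i.
    exists (o - o %% n + i); split; first by lia.
    by apply: val_inj; rewrite /= {1}(divn_eq o n) addnK modnMDl.
  exists (o - o %% n + n + i); split; first by lia.
  by apply: val_inj; rewrite /= {1}(divn_eq o n) addnK -addnA modnMDl modnDl.
exact: xy k ok.
Qed.

Lemma wdesE k w : (pt k \in wdes w) = letter w k && ~~ letter w k.+1.
Proof. by rewrite inE ordS_pt. Qed.

Lemma unbonded_pt i k : i + 2 <= k <= i + n - 2 -> unbonded (pt i) (pt k).
Proof.
move=> ik; rewrite /unbonded !ordS_pt !(@pt_eq i) ?(@pt_eq i.+1); lia.
Qed.

Ltac pos_lia := repeat match goal with
    | H : is_true (letter _ _) |- _ => clear H
    | H : is_true (~~ letter _ _) |- _ => clear H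
  end; lia.

(* All positions must provably lie in [o, o + n[, where equality modulo n is
   equality. *)
Ltac eval_sw o :=
  repeat (rewrite (@letter_sw o); [|pos_lia|pos_lia|pos_lia]);
  repeat match goal with |- context [@eq_op _ ?x ?y] =>
    first [ rewrite (_ : (x == y) = true); last by rewrite eqxx
          | rewrite (_ : (x == y) = true); last by pos_lia
          | rewrite (_ : (x == y) = false); last by pos_lia
          | case: (@eqP _ x y) => ?; [subst|] ] end;
  try solve [reflexivity | assumption
    | repeat match goal with
      | H : is_true (letter ?w ?k) |- context [letter ?w ?k] => rewrite H
      | H : is_true (~~ letter ?w ?k) |- context [letter ?w ?k] =>
          rewrite (negPf H)
      end; reflexivity].

(** * Dyck factors and alternating factors of cyclic words *)

Definition ones (w : word) s j := \sum_(l < j) letter w (s + l).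

Lemma onesS w s j : ones w s j.+1 = ones w s j + letter w (s + j).
Proof. by rewrite /ones big_ord_recr. Qed.

Lemma ones0 w s : ones w s 0 = 0.
Proof. by rewrite /ones big_ord0. Qed.

(** Turning 10 into 01 only changes the prefix that ends between the two letters. *)
Lemma ones_sw w s k j : s <= k -> k.+1 < s + n -> j <= n ->
  letter w k -> ~~ letter w k.+1 ->
  ones (sw k k.+1 w) s j + (s + j == k.+1) = ones w s j.
Proof.
move=> sk ks jn wk wk1; elim: j jn => [_|j IH jn].
  by rewrite !ones0; case: eqP; lia.
rewrite !onesS -(IH (ltnW jn)) (@letter_sw s); [|lia|lia|lia].
rewrite addnS; have [->|] := eqVneq (s + j) k.
  by rewrite wk (negPf wk1); lia.
have [->|] := eqVneq (s + j) k.+1; last by lia.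
by rewrite wk (negPf wk1); lia.
Qed.

Definition dyck w s t :=
  (forall j, j <= 2 * t -> j <= 2 * ones w s j) /\ ones w s (2 * t) = t.

Definition alternating w s t :=
  forall j, j < t -> letter w (s + 2 * j) && ~~ letter w (s + 2 * j).+1.

Lemma ones_add w s j k : ones w s (j + k) = ones w s j + ones w (s + j) k.
Proof.
by elim: k => [|k IH]; rewrite ?ones0 ?addn0 // addnS !onesS IH -!addnA.
Qed.

Lemma onesDn w s j : ones w (s + n) j = ones w s j.
Proof. by apply: eq_bigr => l _; rewrite addnAC letterDn. Qed.

Lemma ones_total w s : ones w s n = a.
Proof.
have pt_inj : injective (fun l : 'I_n => pt (s + l)).
  move=> k l /eqP; have := ltn_ord k; have := ltn_ord l => ln kn.
  by rewrite (@pt_eq s) ?eqn_add2l; [move/eqP/val_inj | lia | lia].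
rewrite -[RHS](eqP (valP w)) -sum1_card [RHS]big_mkcond /= (reindex_inj pt_inj).
by apply: eq_bigr => l _; rewrite /letter; case: (_ \in _).
Qed.

(** Without a factor 110, two consecutive 1s would be followed by 1s up to the end, which is too
    many for a Dyck word. *)
Lemma dyck_alternating w s t : dyck w s t ->
  (forall k, s <= k -> k.+2 < s + 2 * t ->
     letter w k -> letter w k.+1 -> letter w k.+2) ->
  alternating w s t.
Proof.
move=> [wge wt] w110.
suff h j : j <= t -> ones w s (2 * j) = j /\
    forall l, l < j -> letter w (s + 2 * l) && ~~ letter w (s + 2 * l).+1.
  by have [] := h t (leqnn t).
elim: j => [_|j IH jt]; first by rewrite ones0.
have [wj hj] := IH (ltnW jt).
have w1 : letter w (s + 2 * j).
  have := wge (2 * j).+1; rewrite onesS wj.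
  by case: letter => //; lia.
have w0 : ~~ letter w (s + 2 * j).+1.
  apply/negP => w0.
  have ws l : 2 * j + l < 2 * t -> letter w (s + (2 * j + l)).
    elim/ltn_ind: l => -[_ _|[_ _|l IHl lt]]; first by rewrite addn0.
      by rewrite addn1 addnS.
    rewrite !addnS; apply: w110; first by lia.
    - lia.
    - by apply: IHl; lia.
    - by rewrite -!addnS; apply: IHl; lia.
  have wo l : 2 * j + l <= 2 * t -> ones w s (2 * j + l) = j + l.
    elim: l => [|l IHl] lt; first by rewrite !addn0.
    by rewrite addnS onesS IHl ?ws; lia.
  have := wo (2 * (t - j)).
  by have -> : 2 * j + 2 * (t - j) = 2 * t; rewrite ?wt; lia.
split=> [|l].
  rewrite mulnS !addSn add0n !onesS wj w1 addnS (negPf w0); lia.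
by rewrite ltnS leq_eqVlt => /predU1P[->|/hj //]; rewrite w1.
Qed.

(** Replacing a factor 110 by 101 preserves Dyck words and lowers the area under the path; the words
    to which this does not apply are alternating. *)
Lemma dyck_ind (P : word -> Prop) s t : 2 * t <= n ->
  (forall w k, s <= k -> k.+2 < s + 2 * t ->
     letter w k -> letter w k.+1 -> ~~ letter w k.+2 ->
     P (sw k.+1 k.+2 w) -> P w) ->
  (forall w, alternating w s t -> P w) ->
  forall w, dyck w s t -> P w.
Proof.
move=> tn Pred Palt w; pose area w := \sum_(j < 2 * t) ones w s j.
have [N] := ubnP (area w); elim: N w => // N IH w wN Dw.
have [k kP|no] := pickP [pred k : 'I_(2 * t) | [&& k.+2 < 2 * t,
    letter w (s + k), letter w (s + k).+1 & ~~ letter w (s + k).+2]].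
  have /and4P[kt w0 w1 w2] := kP.
  have [wge wt] := Dw.
  have osw j : j <= 2 * t ->
      ones (sw (s + k).+1 (s + k).+2 w) s j + (s + j == (s + k).+2) =
      ones w s j.
    by move=> jt; apply: ones_sw => //; lia.
  apply: (Pred w (s + k)) => //; [lia|lia|]; apply: IH.
    have k2 : k.+2 < 2 * t by [].
    apply: leq_trans (_ : area w <= N); last by [].
    rewrite [area w](bigD1 (Ordinal k2)) //= [area _](bigD1 (Ordinal k2)) //=.
    have := osw k.+2 (ltnW k2); rewrite !addnS eqxx => <-.
    rewrite addn1 addSn !ltnS leq_add2l; apply: leq_sum => j _.
    by rewrite -(osw j) ?leq_addr // ltnW.
  split=> [j jt|].
    (* Only the prefix ending in 11 loses a 1. It can afford this, since it ends with two up
       steps. *)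
    have := osw j jt; have := wge j jt; have [jk|] := eqVneq; last by lia.
    have {jk}-> : j = k.+2 by lia.
    by have := wge k; rewrite !onesS w0 addnS w1; lia.
  by have := osw (2 * t) (leqnn _); rewrite wt; case: eqP; lia.
apply/Palt/dyck_alternating => // k sk kt w0 w1.
have kt' : k - s < 2 * t by lia.
have := no (Ordinal kt'); rewrite /= subnKC // w0 w1 /=.
by case: letter; rewrite ?andbT //; lia.
Qed.

(** * The action of the operators e_i on words *)

Section Edges.
Variables (m : word -> word -> nat).
Hypothesis mR : wrules m.

(* The transpose of q - T_i sends w to - q^{1/2} c x, i.e., e_i w = c x. *)
Definition acts (i : 'I_n) (w : word) (c : nat) (x : word) : Prop :=
  [/\ i \notin wdes w, i \in wdes x
    & forall u, i \in wdes u -> m u w = c * (u == x)].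

Lemma wdes_ordS i w : i \in wdes w -> ordS i \notin wdes w.
Proof. by rewrite !inE => /andP[_ /negPf->]. Qed.

Lemma wdes_bonded i j w : (j == ordS i) || (i == ordS j) ->
  i \in wdes w -> j \notin wdes w.
Proof.
case/orP=> /eqP-> h; first exact: wdes_ordS.
by apply: contraL h; apply: wdes_ordS.
Qed.

Lemma acts_knuth i j k w : let x := sw k k.+1 w in
  (j == ordS i) || (i == ordS j) -> j \in wdes w -> i \in wdes x ->
  acts i w 1 x.
Proof.
move=> x ij jw ix; have ji : (i == ordS j) || (j == ordS i) by rewrite orbC.
have iw := wdes_bonded ji jw; have jx := wdes_bonded ij ix.
have inc u : i \in wdes u -> incomparable (wdes u) (wdes w).
  move=> iu; have ju := wdes_bonded ij iu.
  by apply/andP; split; apply/subsetPn; [exists i | exists j].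
split=> // u iu; have := wr_bond mR ji jw iw.
have mx : m x w = 1.
  move: (inc x ix); rewrite /x /sw -ordS_pt; exact: (wr_knuth mR).
rewrite (bigD1 x) ?ix //= -(wr_sym mR (inc x ix)) mx mul1n.
have [-> //|ux] := eqVneq u x.
rewrite (bigD1 u) /= ?iu ?ux ?(wdes_bonded ij iu) // -(wr_sym mR (inc u iu)).
by case: (m u w) => // l; rewrite mulSn; lia.
Qed.

(* e_i w = e_i (e_k w0) = e_k (e_i w0) = e_k (c y) = c x. *)
Lemma acts_comm i k c w w0 y x : unbonded i k ->
  acts k w0 1 w -> acts i w0 c y -> acts k y 1 x ->
  i \notin wdes w -> i \in wdes x -> acts i w c x.
Proof.
move=> ik [kw0 kw w0w] [iw0 iy w0y] [ky kx yx] iw ix.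
split; [exact: iw | exact: ix | move=> u iu].
have [ku|ku] := boolP (k \in wdes u); last first.
  rewrite (wr_compat mR ik iu ku kw iw).
  by case: eqP => [ux|]; [rewrite ux kx in ku | rewrite muln0].
have := wr_square mR ik iu ku iw0 kw0; rewrite (bigD1 w) ?kw //= w0w // eqxx.
rewrite big1 ?addn0 ?muln1 => [|v /andP[/andP[kv _] /negPf vw]]; last first.
  by rewrite w0w // vw !muln0.
move=> ->; rewrite (bigD1 y) ?iy //= w0y // eqxx yx //.
rewrite big1 => [|v /andP[/andP[iv _] /negPf vy]]; last first.
  by rewrite w0y // vy !muln0.
by rewrite mul1n addn0 muln1 mulnC.
Qed.

Local Opaque letter sw wdes pt.

(** This and the next three lemmas are the Knuth moves, named after the letters at [k], [k.+1],
    [k.+2]. *)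
Lemma acts110 k w : letter w k -> letter w k.+1 -> ~~ letter w k.+2 ->
  acts (pt k) w 1 (sw k.+1 k.+2 w).
Proof.
move=> w0 w1 w2.
apply: (@acts_knuth _ (pt k.+1)); first by rewrite ordS_pt eqxx.
  by rewrite wdesE w1.
by rewrite wdesE; eval_sw k; rewrite w0.
Qed.

Lemma acts010 k w : ~~ letter w k -> letter w k.+1 -> ~~ letter w k.+2 ->
  acts (pt k) w 1 (sw k k.+1 w).
Proof.
move=> w0 w1 w2.
apply: (@acts_knuth _ (pt k.+1)); first by rewrite ordS_pt eqxx.
  by rewrite wdesE w1.
by rewrite wdesE; eval_sw k; rewrite w1.
Qed.

Lemma acts100 k w : letter w k -> ~~ letter w k.+1 -> ~~ letter w k.+2 ->
  acts (pt k.+1) w 1 (sw k k.+1 w).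
Proof.
move=> w0 w1 w2.
apply: (@acts_knuth _ (pt k)); first by rewrite !ordS_pt eqxx orbT.
  by rewrite wdesE w0.
by rewrite wdesE; eval_sw k; rewrite w0.
Qed.

Lemma acts101 k w : letter w k -> ~~ letter w k.+1 -> letter w k.+2 ->
  acts (pt k.+1) w 1 (sw k.+1 k.+2 w).
Proof.
move=> w0 w1 w2.
apply: (@acts_knuth _ (pt k)); first by rewrite !ordS_pt eqxx orbT.
  by rewrite wdesE w0.
by rewrite wdesE; eval_sw k; rewrite w2.
Qed.

Lemma swK p q w : sw p q (sw p q w) = w.
Proof. by apply: val_inj; apply/setP => x; rewrite !inE tpermK. Qed.

(** This is the inductive step for [dyck_ind]. The operator at [k.+1] turns 101 back into 110, both
    in [w0] and in its image under e_i, because [p] and [q] avoid these three positions; [acts_comm]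
    concludes. *)
Lemma acts_red o i k p q c w :
  o <= k -> k.+2 < o + n -> o <= p < o + n -> o <= q < o + n ->
  ~~ (k <= p <= k.+2) -> ~~ (k <= q <= k.+2) -> unbonded i (pt k.+1) ->
  letter w k -> letter w k.+1 -> ~~ letter w k.+2 ->
  i \notin wdes w -> i \in wdes (sw p q w) ->
  let w0 := sw k.+1 k.+2 w in acts i w0 c (sw p q w0) -> acts i w c (sw p q w).
Proof.
move=> ok ko op oq kp kq ik w0 w1 w2 iw ipq v iv.
apply: (acts_comm ik _ iv) => //.
  rewrite -[X in acts _ _ _ X](swK k.+1 k.+2) -/v; apply: acts101.
  all: rewrite /v; eval_sw o.
have -> : sw p q w = sw k.+1 k.+2 (sw p q v).
  apply: (@word_eq o) => l ol; rewrite /v; eval_sw o.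
apply: acts101; rewrite /v; eval_sw o.
Qed.

Lemma unbondedC i j : unbonded i j = unbonded j i.
Proof. by rewrite /unbonded eq_sym [(_ != _) && (i != _)]andbC. Qed.

(** Let [v] be the word 11(10)^t0 with its first 10 turned into 01, so that e_{i+2} v = w. Then e_i
    v is given by a Knuth move, and shows the same pattern two places further with t - 1 for t. *)
Lemma acts_11_alternating t i w : (i + 2 * t).+2 < i + n ->
  letter w i -> letter w i.+1 -> alternating w i.+2 t ->
  ~~ letter w (i + 2 * t).+2 ->
  acts (pt i) w 1 (sw i.+1 (i + 2 * t).+2 w).
Proof.
elim: t i w => [|t IH] i w hc w0 w1 wa wc.
  by rewrite muln0 addn0 in wc *; apply: acts110.
have /andP[w2 w3] : letter w i.+2 && ~~ letter w i.+3.
  by have := wa 0 isT; rewrite muln0 addn0.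
pose v := sw i.+2 i.+3 w; pose y := sw i.+1 i.+2 v.
have ec : (i + 2 * t.+1).+2 = (i.+2 + 2 * t).+2 by lia.
have vw : acts (pt i.+2) v 1 w.
  by rewrite -[w](swK i.+2 i.+3); apply: acts101; rewrite /v; eval_sw i.
have iy : acts (pt i) v 1 y by apply: acts110; rewrite /v; eval_sw i.
have -> : sw i.+1 (i + 2 * t.+1).+2 w = sw i.+3 (i + 2 * t.+1).+2 y.
  by apply: (@word_eq i) => l ol; rewrite /y /v; eval_sw i.
apply: (acts_comm _ vw iy).
- by apply: unbonded_pt; lia.
- rewrite ec; apply: IH; rewrite -?ec; first by lia.
  + by rewrite /y /v; eval_sw i.
  + by rewrite /y /v; eval_sw i.
  + move=> j jt; have := wa j.+1 jt; rewrite /y /v; eval_sw i.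
    by rewrite mulnS !addnA !addn2 addSnnS.
  + by rewrite /y /v; eval_sw i.
- by rewrite wdesE w0 w1.
- by rewrite wdesE; rewrite /y /v; eval_sw i; rewrite w0.
Qed.

(** The same induction on 01(10)^t0, where e_i v now comes from the move 010 to 100. *)
Lemma acts_01_alternating t i w : (i + 2 * t).+2 < i + n ->
  ~~ letter w i -> letter w i.+1 -> alternating w i.+2 t ->
  ~~ letter w (i + 2 * t).+2 ->
  acts (pt i) w 1 (sw i i.+1 w).
Proof.
elim: t i w => [|t IH] i w hc w0 w1 wa wc.
  by rewrite muln0 addn0 in wc *; apply: acts010.
have /andP[w2 w3] : letter w i.+2 && ~~ letter w i.+3.
  by have := wa 0 isT; rewrite muln0 addn0.
pose v := sw i.+2 i.+3 w; pose y := sw i i.+1 v.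
have ec : (i + 2 * t.+1).+2 = (i.+2 + 2 * t).+2 by lia.
have vw : acts (pt i.+2) v 1 w.
  by rewrite -[w](swK i.+2 i.+3); apply: acts101; rewrite /v; eval_sw i.
have iy : acts (pt i) v 1 y by apply: acts010; rewrite /v; eval_sw i.
have -> : sw i i.+1 w = sw i.+2 i.+3 y.
  by apply: (@word_eq i) => l ol; rewrite /y /v; eval_sw i.
apply: (acts_comm _ vw iy).
- by apply: unbonded_pt; lia.
- apply: IH; rewrite -?ec; first by lia.
  + by rewrite /y /v; eval_sw i.
  + by rewrite /y /v; eval_sw i.
  + move=> j jt; have := wa j.+1 jt; rewrite /y /v; eval_sw i.
    by rewrite mulnS !addnA !addn2 addSnnS.
  + by rewrite /y /v; eval_sw i.
- by rewrite wdesE (negPf w0).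
- by rewrite wdesE; rewrite /y /v; eval_sw i; rewrite w1.
Qed.

(** The mirrored induction on 1(10)^t00: the last 10 is turned into 01, and the pattern shrinks from
    the right. *)
Lemma acts_00_alternating t c w : let e := (c + 2 * t).+1 in e.+1 < c + n ->
  letter w c -> alternating w c.+1 t -> ~~ letter w e -> ~~ letter w e.+1 ->
  acts (pt e) w 1 (sw c e w).
Proof.
elim: t w => [|t IH] w e hc wc wa we we1.
  by rewrite /e muln0 addn0 in we we1 *; apply: acts100.
pose d := (c + 2 * t).+1; have ed : e = d.+2 by rewrite /e /d; lia.
rewrite ed in hc we we1 *.
have /andP[w2 w3] : letter w d && ~~ letter w d.+1.
  by have := wa t (leqnn _); rewrite /d addSn.
have cd : c < d by rewrite /d; lia.
pose v := sw d d.+1 w; pose y := sw d.+1 d.+2 v.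
have vw : acts (pt d) v 1 w.
  by rewrite -[w](swK d d.+1); apply: acts010; rewrite /v; eval_sw c.
have iy : acts (pt d.+2) v 1 y.
  by apply: acts100; rewrite /v; eval_sw c.
have -> : sw c d.+2 w = sw c d y.
  by apply: (@word_eq c) => l ol; rewrite /y /v; eval_sw c.
apply: (acts_comm _ vw iy).
- by rewrite unbondedC; apply: unbonded_pt; lia.
- apply: IH; rewrite -/d; first by lia.
  + by rewrite /y /v; eval_sw c.
  + by move=> j jt; have := wa j (ltnW jt); rewrite /y /v; eval_sw c.
  + by rewrite /y /v; eval_sw c.
  + by rewrite /y /v; eval_sw c.
- by rewrite wdesE (negPf we).
- by rewrite wdesE; rewrite /y /v; eval_sw c; rewrite wc.
Qed.

(* Every vertex in the support has descents at i, i + 2, i + 4, ... *)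
Lemma acts_wrap_alternating t i w : n = 2 * t.+1 ->
  ~~ letter w i -> letter w i.+1 -> alternating w i.+2 t ->
  exists c, acts (pt i) w c (sw i i.+1 w).
Proof.
move=> nt w0 w1 wa; set x := sw i i.+1 w.
have w2 : letter w i.+2.
  by have := wa 0; rewrite muln0 addn0 => /(_ _)/andP[]; lia.
have xi : pt i \in wdes x by rewrite wdesE /x; eval_sw i; rewrite w1.
exists (m x w); split=> //; first by rewrite wdesE (negPf w0).
move=> u ui; have [-> |ux] := eqVneq u x; first by rewrite muln1.
rewrite muln0; apply/eqP; apply: contraNT ux => mu.
have ua j : j < t -> pt (i.+2 + 2 * j) \in wdes u.
  move=> jt; apply: contraNT mu => ju; apply/eqP.
  apply: (wr_compat mR (unbonded_pt _) ui ju); first by lia.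
    by rewrite wdesE; apply: wa.
  by rewrite wdesE (negPf w0).
have {}ua l : l < n -> letter u (i + l) = ~~ odd l.
  move=> ln; have [/eqP|l2] := boolP (l./2 == 0).
    move: ui; rewrite wdesE => /andP[u0 u1].
    by case: l {ln} => [|[|l]] // _; rewrite ?addn0 ?addn1 // (negPf u1).
  have := ua (l./2.-1); rewrite wdesE => /(_ _)/andP[]; first by lia.
  case: (boolP (odd l)) => lo.
    by have -> : (i.+2 + 2 * l./2.-1).+1 = i + l; [lia | move=> _ /negPf].
  by have -> : i.+2 + 2 * l./2.-1 = i + l; [lia | move=> ->].
apply/eqP; apply: (@word_eq i) => l il; rewrite /x.
have [l0|l0] := eqVneq l i.
  by have := ua 0 n_gt0; rewrite l0 addn0 => ->; eval_sw i.
have [l1|l1] := eqVneq l i.+1.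
  by have := ua 1 ltac:(lia); rewrite l1 addn1 => ->; eval_sw i.
have -> : letter u l = ~~ odd (l - i) by rewrite -ua ?subnKC //; lia.
rewrite (@letter_sw i); [|lia|lia|lia]; rewrite (negPf l0) (negPf l1).
have := wa ((l - i)./2.-1) => /(_ _)/andP[]; first by lia.
case: (boolP (odd (l - i))) => lo.
  by have -> : (i.+2 + 2 * (l - i)./2.-1).+1 = l; [lia | move=> _ /negPf->].
by have -> : i.+2 + 2 * (l - i)./2.-1 = l; [lia | move=> ->].
Qed.


(** * From alternating factors to arbitrary Dyck factors *)

Lemma acts_11 t i w : (i + 2 * t).+2 < i + n ->
  letter w i -> letter w i.+1 -> dyck w i.+2 t -> ~~ letter w (i + 2 * t).+2 ->
  acts (pt i) w 1 (sw i.+1 (i + 2 * t).+2 w).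
Proof.
move=> hc w0 w1 Dw wc; move: w Dw w0 w1 wc; apply: dyck_ind; first by lia.
  move=> w k ik kt wk wk1 wk2 IH w0 w1 wc.
  apply: (@acts_red i _ k _ _ _ _ _ _ _ _ _ _ _ wk wk1 wk2); try pos_lia.
  - by apply: unbonded_pt; pos_lia.
  - by rewrite wdesE w0 w1.
  - by rewrite wdesE; eval_sw i.
  - by apply: IH; eval_sw i.
by move=> w wa w0 w1 wc; apply: acts_11_alternating.
Qed.

Lemma acts_01 t i w : (i + 2 * t).+2 < i + n ->
  ~~ letter w i -> letter w i.+1 -> dyck w i.+2 t ->
  ~~ letter w (i + 2 * t).+2 -> acts (pt i) w 1 (sw i i.+1 w).
Proof.
move=> hc w0 w1 Dw wc; move: w Dw w0 w1 wc; apply: dyck_ind; first by lia.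
  move=> w k ik kt wk wk1 wk2 IH w0 w1 wc.
  apply: (@acts_red i _ k _ _ _ _ _ _ _ _ _ _ _ wk wk1 wk2); try pos_lia.
  - by apply: unbonded_pt; pos_lia.
  - by rewrite wdesE (negPf w0).
  - by rewrite wdesE; eval_sw i.
  - by apply: IH; eval_sw i.
by move=> w wa w0 w1 wc; apply: (@acts_01_alternating t).
Qed.

Lemma acts_00 t c w : let e := (c + 2 * t).+1 in e.+1 < c + n ->
  letter w c -> dyck w c.+1 t -> ~~ letter w e -> ~~ letter w e.+1 ->
  acts (pt e) w 1 (sw c e w).
Proof.
move=> e hc w0 Dw; move: w Dw w0; apply: dyck_ind; first by lia.
  move=> w k ck kt wk wk1 wk2 IH w0 we we1.
  rewrite /e in hc we we1 *.
  apply: (@acts_red c _ k _ _ _ _ _ _ _ _ _ _ _ wk wk1 wk2); try pos_lia.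
  - by rewrite unbondedC; apply: unbonded_pt; pos_lia.
  - by rewrite wdesE (negPf we).
  - by rewrite wdesE; eval_sw c.
  - by apply: IH; eval_sw c.
by move=> w wa w0 we we1; apply: acts_00_alternating.
Qed.

Lemma acts_wrap t i w : n = 2 * t.+1 ->
  ~~ letter w i -> letter w i.+1 -> dyck w i.+2 t ->
  exists c, acts (pt i) w c (sw i i.+1 w).
Proof.
move=> nt w0 w1 Dw; move: w Dw w0 w1; apply: dyck_ind; first by lia.
  move=> w k ik kt wk wk1 wk2 IH w0 w1.
  have [||c cP] := IH; [by eval_sw i | by eval_sw i |].
  (* The reduction leaves the multiplicity unchanged, so it is the one of the alternating word. *)
  exists c.
  apply: (@acts_red i _ k _ _ _ _ _ _ _ _ _ _ _ wk wk1 wk2); try pos_lia.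
  - by apply: unbonded_pt; pos_lia.
  - by rewrite wdesE (negPf w0).
  - by rewrite wdesE; eval_sw i.
  - exact: cP.
by move=> w wa w0 w1; apply: (@acts_wrap_alternating t).
Qed.

End Edges.

(** * Parenthesis matching around the circle *)

Lemma first_return w s N : (exists2 j, j <= N & 2 * ones w s j < j) ->
  exists t, [/\ 2 * t < N, dyck w s t & ~~ letter w (s + 2 * t)].
Proof.
move=> [N' N'N hN']; have ex : exists j, 2 * ones w s j < j by exists N'.
(* The first prefix with more 0s than 1s ends with the 0 that closes a parenthesis opened just
   before [s]. *)
case: (ex_minnP ex) => -[//|j] hj jmin; have jN' := jmin _ hN'.
have wge l : l <= j -> l <= 2 * ones w s l.
  by rewrite leqNgt [_ <= _ in X in _ -> X]leqNgt; apply: contra => /jmin; lia.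
have := wge j (leqnn _); rewrite onesS in hj => wj.
exists (ones w s j); have -> : 2 * ones w s j = j by lia.
split=> //; first by lia.
  by split; have -> : 2 * ones w s j = j by lia.
by case: letter hj => //; lia.
Qed.

Hypothesis na : n = 2 * a.

(** The path ends at height 2. After its last visit to a height at most 1 it goes up at [c] and
    stays at height 2 or more, so [c] matches a 0 placed just after the factor. *)
Lemma last_ascent w s N : ones w s (2 * N) = N.+1 ->
  exists c t,
    [/\ s <= c, c + 2 * t + 1 = s + 2 * N, letter w c & dyck w c.+1 t].
Proof.
move=> wN; pose P j := (j <= 2 * N) && (2 * ones w s j <= j.+1).
have ex : exists j, P j by exists 0; rewrite /P ones0.
have bnd j : P j -> j <= 2 * N by case/andP.
case: (ex_maxnP ex bnd) => j /andP[jN hj] jmax.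
have wge l : j < l <= 2 * N -> l.+2 <= 2 * ones w s l.
  move=> /andP[jl lN]; have := jmax l; rewrite /P lN /=.
  by case: leqP => // _ /(_ isT); lia.
have jN' : j < 2 * N.
  by rewrite ltn_neqAle jN andbT; apply: contraTneq hj => ->; rewrite wN; lia.
have := wge j.+1; rewrite ltnSn jN' onesS => /(_ isT) hj1.
have wj : letter w (s + j) by case: letter hj1 => //; lia.
rewrite wj in hj1.
exists (s + j), (N - ones w s j); split=> //; [by lia | by lia |].
have oE l : ones w s (j.+1 + l) = (ones w s j).+1 + ones w (s + j).+1 l.
  by rewrite ones_add onesS wj addn1 addnS.
split=> [l lN|].
  by have := wge (j.+1 + l); rewrite oE; lia.
have := oE (2 * (N - ones w s j)).
have -> : j.+1 + 2 * (N - ones w s j) = 2 * N by lia.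
by rewrite wN; lia.
Qed.

(* In the second case i and i + 1 are matched around the circle. *)
Lemma acts_cases w i : pt i \notin wdes w ->
  (exists x, forall m, wrules m -> acts m (pt i) w 1 x)
  \/ [/\ ~~ letter w i, letter w i.+1 & dyck w i.+2 a.-1].
Proof.
rewrite wdesE => iw.
have two : ones w i n = letter w i + letter w i.+1 + ones w i.+2 (n - 2).
  have {1}-> : n = 2 + (n - 2) by lia.
  by rewrite ones_add !onesS ones0 addn0 addn1 addn2.
rewrite ones_total in two.
have [w0|w0] := boolP (letter w i); have [w1|w1] := boolP (letter w i.+1).
(* The remaining n - 2 letters contain a - 2 ones, fewer than half, so the parenthesis opened at i +
   1 closes among them. *)
- left; have [|t [tn Dt ct]] := @first_return w i.+2 (n - 2).
    by exists (n - 2) => //; lia.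
  by eexists => m mR; apply: (acts_11 mR _ w0 w1 Dt); rewrite ?addSn //; lia.
- by rewrite w0 w1 in iw.
- have [h|h] := boolP [forall j : 'I_(n - 2).+1, j <= 2 * ones w i.+2 j].
    right; split=> //; have e : 2 * a.-1 = n - 2 by lia.
    split; last by rewrite e; lia.
    rewrite e => j jn; have jn' : j < (n - 2).+1 by [].
    exact: (forallP h (Ordinal jn')).
  have [|t [tn Dt ct]] := @first_return w i.+2 (n - 2).
    move: h; rewrite negb_forall => /existsP[j]; rewrite -ltnNge => hj.
    by exists j => //; have := ltn_ord j; lia.
  left; exists (sw i i.+1 w) => m mR.
  by apply: (acts_01 mR _ w0 w1 Dt); rewrite -?addSn //; lia.
(* Now the remaining letters contain a ones; [c] is the partner of the 0 at [i], read as position i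
   + n. *)
- left; have [|c [t [ic ct wc Dt]]] := @last_ascent w i.+2 a.-1.
    by have -> : 2 * a.-1 = n - 2; lia.
  have ei : (c + 2 * t).+1 = i + n by lia.
  exists (sw c (i + n) w) => m mR; rewrite -(ptDn i) -ei.
  by apply: acts_00 => //; rewrite ei -?addSn ?letterDn //; lia.
Qed.

(** The cycle lemma: reading starts where the path is lowest. [F] is its height, shifted by [n] to
    remain a natural number. *)
Lemma dyck_rotation w : exists s, dyck w s a.
Proof.
pose F s := 2 * ones w 0 s + (n - s).
case: (@arg_minnP _ (Ordinal n_gt0) xpredT F isT) => s _ smin; exists s.
split=> [j jn|]; last by rewrite -na ones_total.
have := ones_add w 0 s j; rewrite add0n.
have [sj|sj] := ltnP (s + j) n => o_sj.
  by have := smin (Ordinal sj) isT; rewrite /F /= o_sj; lia.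
have sn := ltn_ord s; have ln : s + j - n < n by lia.
have := smin (Ordinal ln) isT; rewrite /F /=.
(* A full turn has height 0, so past position [n] the heights repeat. *)
have sjE : s + j = n + (s + j - n) by lia.
rewrite sjE ones_add ones_total add0n -[n in ones w n _]add0n onesDn in o_sj.
by lia.
Qed.

Lemma alternatingE x s k : alternating x s a -> s <= k ->
  letter x k = ~~ odd (k - s).
Proof.
move=> xa; elim/ltn_ind: k => k IH sk; have [kn|nk] := ltnP k (s + n).
  have /andP[] := xa ((k - s)./2) ltac:(lia).
  have [ko|ke] := boolP (odd (k - s)).
    by have -> : (s + 2 * (k - s)./2).+1 = k; [lia | move=> _ /negPf].
  by have -> : s + 2 * (k - s)./2 = k by lia.
have {1}-> : k = k - n + n by lia.
by rewrite letterDn IH; lia.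
Qed.

Lemma alternating_uniq x y s t : odd s = odd t ->
  alternating x s a -> alternating y t a -> x = y.
Proof.
move=> st xa ya; apply: (@word_eq (s + t)) => k hk.
by rewrite (alternatingE xa) ?(alternatingE ya); lia.
Qed.

(** * Connectedness through the two alternating words *)

Section Connectivity.
Variable m : word -> word -> nat.
Hypothesis mR : wrules m.

Definition linked x y := (m x y != 0) || (m y x != 0).

Lemma connect_linkedC : connect_sym linked.
Proof. by apply: sym_connect_sym => x y; rewrite /linked orbC. Qed.

(** Each reduction of [dyck_ind] is a Knuth move, hence an edge. *)
Lemma connect_alternating w s : dyck w s a ->
  exists x, alternating x s a /\ connect linked w x.
Proof.
move: w; apply: dyck_ind; first by rewrite na.
  move=> w k sk kt w0 w1 w2 [x [xa vx]]; exists x; split=> //.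
  apply: connect_trans vx; apply: connect1.
  set v := sw _ _ _.
  have [_ wk] : acts m (pt k.+1) v 1 w.
    rewrite -[w](swK k.+1 k.+2) -/v.
    by apply: acts101 => //; rewrite /v; eval_sw k.
  by move=> /(_ w wk) mvw; rewrite /linked mvw eqxx.
by move=> w wa; exists w.
Qed.

(** Around the circle [w] is a Dyck word from i + 1, and after the exchange it is one from [i].
    Their alternating words have opposite parity, so this edge joins the only two alternating words,
    and every word is linked to one of them. *)
Lemma connected_of_wrap w i : ~~ letter w i -> letter w i.+1 ->
  dyck w i.+2 a.-1 -> m (sw i i.+1 w) w != 0 -> forall x y, connect linked x y.
Proof.
move=> w0 w1 [wge wt] mw.
have na' : n = (2 * a.-1).+2 by lia.
have Dw : dyck w i.+1 a.
  split; last by rewrite -na ones_total.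
  have wS l : ones w i.+1 l.+1 = (ones w i.+2 l).+1.
    have -> : l.+1 = 1 + l by [].
    by rewrite ones_add onesS ones0 addn0 w1 addn1.
  move=> [//|j] jn; rewrite wS; have [jn'|jn'] := leqP j (2 * a.-1).
    by have := wge j jn'; lia.
  have -> : j = (2 * a.-1).+1 by lia.
  by rewrite onesS wt; lia.
have Dx : dyck (sw i i.+1 w) i a.
  split; last by rewrite -na ones_total.
  have x0 : letter (sw i i.+1 w) i by eval_sw i.
  have x1 : ~~ letter (sw i i.+1 w) i.+1 by eval_sw i.
  have xS l : l <= 2 * a.-1 ->
      ones (sw i i.+1 w) i l.+2 = (ones w i.+2 l).+1.
    move=> ln; have -> : l.+2 = 2 + l by [].
    rewrite ones_add !onesS ones0 addn0 addn1 x0 (negPf x1) addn2.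
    rewrite add1n; congr _.+1; apply: eq_bigr => j _.
    by have jl := ltn_ord j; eval_sw i.
  move=> [//|[|j]] jn; first by rewrite onesS addn0 x0; lia.
  by rewrite xS; [have := wge j; lia | lia].
have [x0 [x0a wx0]] := connect_alternating Dw.
have [x1 [x1a xx1]] := connect_alternating Dx.
have wx : connect linked w (sw i i.+1 w).
  by apply: connect1; rewrite /linked mw orbT.
have to_w u : connect linked u w.
  have [s Ds] := dyck_rotation u; have [z [za uz]] := connect_alternating Ds.
  apply: connect_trans uz _; rewrite connect_linkedC.
  have [si|si] := eqVneq (odd s) (odd i).
    by rewrite (alternating_uniq si za x1a) (connect_trans wx).
  have si' : odd s = odd i.+1 by move: si; rewrite /=; do 2 case: odd.
  by rewrite (alternating_uniq si' za x0a).
by move=> x y; apply: (connect_trans (to_w x)); rewrite connect_linkedC to_w.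
Qed.

End Connectivity.

(** A descent [i] of [u] outside [wdes w] makes m(u > w) a coefficient of e_i w. Either e_i w is the
    same word for all weights, or its multiplicity is zero because the graph would otherwise be
    connected. *)
Lemma disconnected_rigid m m' : wrules m -> wrules m' ->
  ~ (forall x y, connect (linked m) x y) ->
  forall u w, ~~ (wdes u \subset wdes w) -> m u w = m' u w \/ m u w = 0.
Proof.
move=> mR mR' mdisc u w /subsetPn[i iu iw]; rewrite -(pt_val i) in iu iw.
have [[x actx]|[w0 w1 Dw]] := acts_cases iw.
  by have [_ _ ->] // := actx m mR; have [_ _ ->] // := actx m' mR'; left.
have [|c [_ wx cP]] := acts_wrap mR _ w0 w1 Dw; first by lia.
right; rewrite cP //; case: c cP => // c cP; case: mdisc.
by apply: (connected_of_wrap mR w0 w1 Dw); rewrite cP // eqxx.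
Qed.

End Words.

(** * Row-standard tableaux *)

Lemma sorted_enum_ord n (A : {pred 'I_n}) :
  sorted (fun i j : 'I_n => i < j) (enum A).
Proof.
rewrite /enum_mem; apply: sorted_filter.
  by move=> ? ? ?; apply: ltn_trans.
by have := iota_ltn_sorted 0 n; rewrite -val_enum_ord sorted_map enumT.
Qed.

Section Rows.
Variables (n : nat) (la : seq nat).
Implicit Types T : rsyt n la.

Definition mkbox (r : 'I_(size la)) (j : 'I_(nth 0 la r)) : box la :=
  Tagged (fun r : 'I_(size la) => 'I_(nth 0 la r)) j.

Definition row_set T (r : 'I_(size la)) : {set 'I_n} :=
  [set val T b | b in [pred b : box la | tag b == r]].

Lemma rsyt_fiber T k : exists b, [set b' | val T b' == k] = [set b].
Proof.
by have /andP[/forallP/(_ k)/cards1P] := valP T.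
Qed.

Lemma rsyt_surj T k : exists b, val T b = k.
Proof.
by have [b /setP/(_ b)] := rsyt_fiber T k; rewrite !inE eqxx => /eqP; exists b.
Qed.

Lemma rsyt_inj T : injective (val T).
Proof.
move=> b b' e; have [c /setP cE] := rsyt_fiber T (val T b).
have := cE b; have := cE b'; rewrite !inE e eqxx.
by move=> /esym/eqP-> /esym/eqP->.
Qed.

Lemma mem_row_set T b r : (val T b \in row_set T r) = (tag b == r).
Proof.
apply/imsetP/idP => [[b' br /rsyt_inj->]|br]; first by [].
by exists b.
Qed.

(** Strictly increasing lists with the same elements are equal, so a row is recovered from its set
    of entries. *)
Lemma enum_row_set T (r : 'I_(size la)) :
  enum (row_set T r) =
  [seq val T (mkbox j)
     | j <- enum 'I_(nth 0 la r)].
Proof.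
apply: (@irr_sorted_eq _ (fun i j : 'I_n => i < j)).
- by move=> i j k; apply: ltn_trans.
- by move=> i; apply: ltnn.
- exact: sorted_enum_ord.
- rewrite sorted_map; apply: sub_sorted (sorted_enum_ord _) => i j ij.
  have /andP[_ /forallP/(_ (mkbox i))] := valP T.
  by move=> /forallP/(_ (mkbox j)); rewrite eqxx ij.
- move=> k; rewrite mem_enum.
  apply/imsetP/mapP => [[[r' j] /eqP/= e ->]|[j _ ->]].
    by subst r'; exists j; rewrite ?mem_enum.
  by exists (mkbox j); rewrite ?inE /=.
Qed.

Lemma card_row_set T r : #|row_set T r| = nth 0 la r.
Proof. by rewrite cardE enum_row_set size_map size_enum_ord. Qed.

Lemma row_set_inj T T' : row_set T =1 row_set T' -> T = T'.
Proof.
move=> TT'; apply: val_inj; apply/ffunP => -[r j].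
have := enum_row_set T r; rewrite TT' enum_row_set.
by move/eq_in_map => /(_ j); rewrite mem_enum => /(_ isT).
Qed.

Lemma rsyt_of_rows (k0 : 'I_n) (S : 'I_(size la) -> {set 'I_n}) :
  (forall r, #|S r| = nth 0 la r) ->
  (forall k, exists r, forall r', (k \in S r') = (r' == r)) ->
  exists T, row_set T =1 S.
Proof.
move=> cS uS; pose F : {ffun box la -> 'I_n} :=
  [ffun b : box la => nth k0 (enum (S (tag b))) (tagged b)].
have szS r : size (enum (S r)) = nth 0 la r by rewrite -cardE cS.
have FS b : F b \in S (tag b).
  by rewrite ffunE -mem_enum mem_nth // szS ltn_ord.
have rowS k r r' : k \in S r -> k \in S r' -> r = r'.
  by have [q qP] := uS k; rewrite !qP => /eqP-> /eqP->.
have F_inj : injective F.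
  move=> [r j] [r' j'] e.
  have := FS (mkbox j); rewrite /= e => /(rowS _ _ _ (FS _)).
  move=> /= rr'; subst r'; move: e; rewrite !ffunE /= => /eqP.
  by rewrite nth_uniq ?enum_uniq ?szS // => /eqP/val_inj->.
have F_rs : row_standard F.
  apply/andP; split.
    apply/forallP => k; have [r rP] := uS k.
    have kr : k \in enum (S r) by rewrite mem_enum rP.
    have ir : index k (enum (S r)) < nth 0 la r by rewrite -szS index_mem.
    pose b : box la := mkbox (Ordinal ir).
    have Fb : F b = k by rewrite ffunE /= nth_index.
    apply/cards1P; exists b; apply/setP => b'.
    by rewrite !inE -Fb (inj_eq F_inj).
  apply/forallP => -[r j]; apply/forallP => -[r' j']; apply/implyP => /=.
  case/andP=> /eqP rr'; subst r' => jj'; rewrite !ffunE /=.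
  apply: (sorted_ltn_nth _ k0 (sorted_enum_ord (S r))); rewrite ?inE ?szS //.
  by move=> ? ? ?; apply: ltn_trans.
exists (exist _ F F_rs) => r; apply/setP => k.
apply/imsetP/idP => [[b /eqP <- ->]|kr]; first exact: FS.
have [b bk] := rsyt_surj (exist _ F F_rs) k; exists b => //.
by rewrite inE /=; apply/eqP/(rowS k) => //; rewrite -bk FS.
Qed.

End Rows.

(** * Tableaux of shape (a, a) as cyclic words *)

Section TwoRows.
Variables (a n : nat).
Hypotheses (na : n = 2 * a) (n_gt0 : 0 < n).
Local Notation la := [:: a; a].
Implicit Types T : rsyt n la.

Fact upper_subproof T : #|row_set T (ord0 : 'I_2)| == a.
Proof. by rewrite card_row_set. Qed.

Definition upper T : word a n :=
  exist (fun w : {set 'I_n} => #|w| == a) _ (upper_subproof T).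

Lemma mem_upper T b : (val T b \in val (upper T)) = (tag b == 0 :> nat).
Proof. by rewrite /= mem_row_set -val_eqE. Qed.

Lemma mem_row_upper T r k :
  (k \in row_set T r) = ((k \in val (upper T)) == (r == 0 :> nat)).
Proof.
have [b <-] := rsyt_surj T k; rewrite mem_upper mem_row_set -val_eqE /=.
by case: (tag b) r => [[|[|?]] ?] [[|[|?]] ?].
Qed.

Lemma upper_inj : injective upper.
Proof.
move=> T T' TT'; apply: row_set_inj => r; apply/setP => k.
by rewrite mem_row_upper [RHS]mem_row_upper TT'.
Qed.

Lemma upper_surj w : exists T, upper T = w.
Proof.
pose S (r : 'I_(size la)) := [set k | (k \in val w) == (r == 0 :> nat)].
have [||T TS] := @rsyt_of_rows n la (Ordinal n_gt0) S.
- have cw := eqP (valP w); move=> [[|[|//]] r_lt] /=.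
    by rewrite -[RHS]cw; apply: eq_card => k; rewrite inE eqb_id.
  have := cardsC (val w); rewrite cw card_ord => cC.
  have -> : S (Ordinal r_lt) = ~: val w.
    by apply/setP => k; rewrite !inE; case: (_ \in _).
  by apply/eqP; rewrite -(eqn_add2l a) cC na mul2n addnn.
- move=> k; exists (if k \in val w then ord0 else (ord_max : 'I_2)) => r.
  by rewrite inE; case: (_ \in _); case: r => [[|[|?]] ?].
exists T; apply: val_inj; rewrite /= TS; apply/setP => k.
by rewrite inE eqb_id.
Qed.

Lemma des_upper T : des T = wdes (upper T).
Proof.
apply/setP => i; rewrite inE [RHS]inE.
have [b <-] := rsyt_surj T i; have [b' b'E] := rsyt_surj T (ordS (val T b)).
rewrite -b'E !mem_upper.
apply/existsP/idP => [[c /existsP[c' /and3P[]]]|bb'].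
  move=> /eqP/rsyt_inj-> /eqP/rsyt_inj->.
  by case: (tag b) (tag b') => [[|[|?]] ?] [[|[|?]] ?].
exists b; apply/existsP; exists b'; rewrite !eqxx /=.
by case: (tag b) (tag b') bb' => [[|[|?]] ?] [[|[|?]] ?].
Qed.

Lemma knuth_move_swap T T' i : upper T' = swap i (ordS i) (upper T) ->
  incomparable (wdes (upper T)) (wdes (upper T')) -> knuth_move T T'.
Proof.
move=> T'E inc; rewrite /knuth_move !des_upper inc /=.
(* [s] sends a box of [T'] to the box of [T] that holds the exchanged entry. It preserves rows
   because the exchange matches the upper rows. *)
have [s sP] :=
  boolp.choice (fun b => rsyt_surj T (tperm i (ordS i) (val T' b))).
have s_inj : injective s.
  move=> b b' e; apply: (@rsyt_inj _ _ T').
  apply: (@perm_inj _ (tperm i (ordS i))).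
  by rewrite -!sP e.
apply/existsP; exists i; apply/existsP; exists (perm s_inj).
apply/forallP => b; rewrite (permE s_inj) sP tpermK eqxx andbT.
have := mem_upper T' b; rewrite T'E /= inE -sP -/(val (upper T)).
rewrite (mem_upper T (s b)).
by case: (tag b) (tag (s b)) => [[|[|?]] ?] [[|[|?]] ?].
Qed.

End TwoRows.

(** * From W-graphs to words, and the embedding *)

Lemma wrules_of_wgraph (a n : nat) (V : choiceType) (G : lgraph 'I_n V) :
  n = 2 * a -> 2 < n -> nb_admissible G -> wgraph (@affine_sym n) G ->
  isomorphic (underlying G) (dbar n [:: a; a]) ->
  exists (g : word a n -> V) (m : word a n -> word a n -> nat),
    [/\ bijective g, forall w, lg_tau G (g w) = wdes w,
        forall u w, lg_m G (g u) (g w) = (m u w)%:R%R & wrules m].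
Proof.
move=> na n_gt2 [Gnat Gsym] GW [f [[f' fK f'K] fm ftau]].
have n_gt0 : 0 < n by apply: leq_trans n_gt2.
have [t tK] := boolp.choice (upper_surj na n_gt0).
have Kt : cancel (@upper a n) t by move=> T; apply: upper_inj; rewrite tK.
pose g w := f' (t w).
have g_bij : bijective g.
  by exists (fun v => upper (f v)) => x; rewrite /g ?f'K ?tK ?Kt ?fK.
have gtau w : lg_tau G (g w) = wdes w.
  by have /= <- := ftau (g w); rewrite /g f'K des_upper tK.
have /boolp.choice[mp mpP] : forall p : word a n * word a n, exists k,
    lg_m G (g p.1) (g p.2) = k%:R%R by move=> p; apply: Gnat.
pose m u w := mp (u, w); have gm u w : lg_m G (g u) (g w) = (m u w)%:R%R.
  exact: mpP (u, w).
have natI k l : (k%:R = l%:R :> laurent)%R -> k = l.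
  by move=> kl; apply: (@laurent_natr_inj 1%R); rewrite ?mem_head // kl.
have cox2 (i j : 'I_n) : unbonded i j -> i != j /\ affine_sym i j = 2.
  case/and3P=> ij ji ij'; split=> //.
  by rewrite /affine_sym (negPf ij) leqNgt n_gt2 /= (negPf ji) (negPf ij').
exists g, m; split=> //; split.
- move=> i w x inc; apply: natI; rewrite -gm.
  (* An edge of the simple underlying graph certifies weight 1 in [G]. *)
  have : underlying_m G (g x) (g w) = 1%R.
    have /= <- := fm (g x) (g w); rewrite /g !f'K /dbar_m.
    have -> // : knuth_move (t x) (t w).
    apply: (@knuth_move_swap a n _ _ i); rewrite !tK //.
    by apply: val_inj; apply/setP => k; rewrite !inE tpermK.
  rewrite /underlying_m; case: ifP => [/andP[/eqP-> _] //|_ /esym/eqP].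
  by rewrite oner_eq0.
- move=> u w inc; apply: natI; rewrite -!gm; apply: Gsym; by rewrite !gtau.
- move=> i j u w /cox2[ij cij] iu ju jw iw.
  by apply: (wgraph_compat g_bij GW gm ij cij); rewrite gtau.
- move=> i j u w /cox2[ij cij] iu ju iw jw.
  have := wgraph_square g_bij GW gm ij cij (u := u) (w := w).
  rewrite !gtau => /(_ iu ju iw jw).
  by under eq_bigl do rewrite !gtau; under [RHS]eq_bigl do rewrite !gtau.
move=> i j u ij iu ju.
have ij' : i != j by apply: contraNneq ju => <-.
have cij : affine_sym i j = 3.
  by rewrite /affine_sym (negPf ij') leqNgt n_gt2 /= ij.
have := wgraph_bond g_bij GW gm ij' cij (u := u); rewrite !gtau => /(_ iu ju).
by under eq_bigl do rewrite !gtau.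
Qed.

Theorem theorem9p6 (a n : nat) (hna : n = 2 * a) (hn : 3 <= n)
    (V V' : choiceType) (G : lgraph 'I_n V) (G' : lgraph 'I_n V')
    (hGred : reduced G) (hGadm : nb_admissible G)
    (hGW : wgraph (@affine_sym n) G)
    (hG'red : reduced G') (hG'adm : nb_admissible G')
    (hG'W : wgraph (@affine_sym n) G')
    (hGU : isomorphic (underlying G) (dbar n [:: a; a]))
    (hG'U : isomorphic (underlying G') (dbar n [:: a; a]))
    (hGdisc : disconnected G) :
  embeds G G'.
Proof.
have [g [m [[h gK hK] gtau gm mR]]] := wrules_of_wgraph hna hn hGadm hGW hGU.
have [g' [m' [[h' g'K h'K] g'tau g'm mR']]] :=
  wrules_of_wgraph hna hn hG'adm hG'W hG'U.
have n_ge4 : 4 <= n by lia.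
have natr0 k : ((k%:R == 0 :> laurent) = (k == 0))%R.
  apply/eqP/eqP => [k0|-> //].
  by apply: (@laurent_natr_inj 1%R); rewrite ?mem_head // k0.
have mdisc : ~ forall x y, connect (linked m) x y.
  move=> mconn; apply: hGdisc => u v.
  have /connectP[p pP pv] := mconn (h u) (h v).
  exists [seq g x | x <- p]; last by rewrite -[u]hK last_map -pv hK.
  rewrite -[u]hK; apply: homo_path pP => x y.
  by rewrite /linked /edge !gm !natr0.
have key u w : lg_m G (g u) (g w) = lg_m G' (g' u) (g' w)
    \/ lg_m G (g u) (g w) = 0%R.
  have [uw|uw] := boolP (wdes u \subset wdes w).
    by right; apply: hGred; rewrite !gtau.
  rewrite gm g'm.
  by have [->|->] := disconnected_rigid n_ge4 hna mR mR' mdisc uw; [left|right].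
(* The subgraph keeps every vertex of [G'] and carries the weights of [G], transported through
   words. *)
pose S := {v : V' | xpredT v}.
pose back (x : S) : V := g (h' (val x)).
pose forth (v : V) : S := exist (fun v => xpredT v) (g' (h v)) isT.
have forthK : cancel forth back by move=> v; rewrite /back /= g'K hK.
have backK : cancel back forth.
  by move=> x; apply: val_inj; rewrite /= gK h'K.
have nbrsP x y : (y \in [fset forth v | v in lg_nbrs G (back x)]%fset) =
    (lg_m G (back x) (back y) != 0%R) || (lg_m G (back y) (back x) != 0%R).
  rewrite -lg_nbrsP; apply/imfsetP/idP => /= [[v vx ->]|yx].
    by rewrite forthK.
  by exists (back y); rewrite ?backK.
exists xpredT, (LGraph (lg_tau G \o back) nbrsP); split.
  split=> [x|x y] /=; first by rewrite /back gtau -g'tau h'K.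
  by have := key (h' (val x)) (h' (val y)); rewrite !h'K.
exists forth; split=> [|u v|v]; first by exists back.
  by rewrite /= !forthK.
by rewrite /= forthK.
Qed.
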